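(* Let $f\in\mathcal{F}_3$, i.e. $f\in\mathcal{S}$ and $\operatorname{Re}\{(1-z+z^2)f'(z)\}>0$ for all $z\in\mathbb{D}$. Then the third logarithmic coefficient $\gamma_3$ of $f$ satisfies $$|\gamma_3|\leq \frac{17.75}{48}=0.36979\cdots.$$
   Context: $\mathbb{D}=\{z\in\mathbb{C}:|z|<1\}$ is the open unit disk. $\mathcal{A}$ is the set of all analytic functions $f$ in $\mathbb{D}$ of the form $f(z)=\sum_{n=1}^{\infty}a_nz^n$ with $a_1=1$ (that is, $f(0)=0$, $f'(0)=1$), and $\mathcal{S}\subset\mathcal{A}$ is the subclass of functions univalent (injective) in $\mathbb{D}$. $\mathcal{F}_3$ is the class of $f\in\mathcal{S}$ with $\operatorname{Re}\{(1-z+z^2)f'(z)\}>0$ for all $z\in\mathbb{D}$. For $f\in\mathcal{S}$, the logarithmic coefficients $\gamma_n$ ($n\ge 1$) of $f$ are the complex numbers defined by $\log\frac{f(z)}{z}=2\sum_{n=1}^{\infty}\gamma_nz^n$, $z\in\mathbb{D}\setminus\{0\}$, where the branch of the logarithm is the one with $\log 1=0$ (i.e. the analytic branch of $\log(f(z)/z)$ on $\mathbb{D}$ vanishing at $z=0$, where $f(z)/z$ is given the value $1$ at $0$). The coefficients $a_n$ may be complex. *)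

(* Defs.v *)
From Stdlib Require Export Reals.
From Coquelicot Require Export Coquelicot.

Open Scope R_scope.

Definition unit_disk (z : C) : Prop := Cmod z < 1.

Definition analytic_on_disk (f : C -> C) : Prop :=
  forall z : C, unit_disk z -> ex_derive f z.

Definition class_A (f : C -> C) : Prop :=
  analytic_on_disk f /\
  exists a : nat -> C,
    a 0%nat = RtoC 0 /\ a 1%nat = RtoC 1 /\
    forall z : C, unit_disk z -> is_pseries a z (f z).

(* Functions are total on C; their values outside the disk are irrelevant. *)
Definition univalent_on_disk (f : C -> C) : Prop :=
  forall z w : C, unit_disk z -> unit_disk w -> f z = f w -> z = w.

Definition class_S (f : C -> C) : Prop :=
  class_A f /\ univalent_on_disk f.

(* [C_derive] is a total operator; on the disk it is the complex derivative of
   [f], because membership in [class_S] makes [f] differentiable there. *)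
Definition class_F3 (f : C -> C) : Prop :=
  class_S f /\
  forall z : C, unit_disk z -> 0 < Re ((1 - z + z * z) * C_derive f z)%C.

(* e^(x + iy) = e^x (cos y + i sin y). *)
Definition Cexp (z : C) : C :=
  (exp (Re z) * cos (Im z), exp (Re z) * sin (Im z)).

(* The analytic branch on the disk of log (f(z) / z) that vanishes at 0.  The
   point 0 is excluded from the equation since Coquelicot gives f(0) / 0 the
   value 0; with the value 1 there, the equation at 0 is implied by
   [L 0 = 0]. *)
Definition log_branch (f L : C -> C) : Prop :=
  analytic_on_disk L /\ L (RtoC 0) = RtoC 0 /\
  forall z : C, unit_disk z -> z <> RtoC 0 -> Cexp (L z) = (f z / z)%C.

(* log (f(z) / z) = 2 * sum_(n >= 1) gamma_n z^n.  The series is reindexed from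
   0, so the value [gamma 0] plays no role. *)
Definition log_coefficients (f : C -> C) (gamma : nat -> C) : Prop :=
  exists L : C -> C, log_branch f L /\
    forall z : C, unit_disk z -> z <> RtoC 0 ->
      exists s : C,
        is_series (fun n : nat => (gamma (S n) * z ^ S n)%C) s /\
        L z = (2 * s)%C.

(* Main.v *)
(* Write p(z) = (1 - z + z^2) f'(z) = (1 + w) / (1 - w) with w = b1 z + b2 z^2 + ...
   a self-map of the disk.  Comparing coefficients,
     48 gamma_3 = 12 b3 + 8 b1 b2 + 4 b1^3 + 4 b2 - 2 b1 - 5.
   Averaging Re p |q|^2 over the circle for cubic polynomials q shows that the
   Toeplitz form of p is nonnegative, hence that the lower triangular Toeplitz
   matrix of (b1, b2, b3) is a contraction.  The Schur algorithm then gives, with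
   D = 1 - |b1|^2, b2 = D y and b3 = D (t - conj(b1) y^2) where |t| <= 1 - |y|^2.
   The triangle inequality leaves a function of r = |b1| and s = |y| whose maximum,
   attained at r = 1/4 and s = 1/3, is 17.75.  The circle averages are taken over
   roots of unity, and gamma_3 is read off from expansions of f(t) / t and
   exp (log (f(t) / t)) as t decreases to 0 along the reals. *)
Require Import Defs.
From Stdlib Require Import Reals Lra Lia.
From Coquelicot Require Import Coquelicot.

(** * Complex power series on the disk *)

Lemma is_pseries_C (a : nat -> C) (z l : C) :
  is_pseries a z l <-> is_series (fun n => (a n * z ^ n)%C) l.
Proof.
  assert (H : forall n, scal (pow_n z n) (a n) = (a n * z ^ n)%C).
  { intros n.
    replace (pow_n z n) with (z ^ n)%C; [apply Cmult_comm|].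
    induction n as [|n IH]; simpl; [reflexivity|now rewrite IH]. }
  split; apply is_series_ext; intros n; [|symmetry]; apply H.
Qed.

(** The partial sums are compared with those of the geometric series, and the bound passes to the
    limit. Power series tails, Taylor remainders and the real exponential all use it. *)
Lemma norm_series_geom {K : AbsRing} {V : NormedModule K} (s : nat -> V) (l : V)
    (M q : R) :
  0 <= q < 1 -> (forall n, norm (s n) <= M * q ^ n) -> is_series s l ->
  norm l <= M / (1 - q).
Proof.
  intros Hq Hs Hl.
  assert (HM : 0 <= M).
  { specialize (Hs 0%nat). pose proof (norm_ge_0 (s 0%nat)). simpl in Hs. lra. }
  assert (Hpart : forall n, norm (sum_n s n) <= M / (1 - q)).
  { intros n.
    (* The exact geometric partial sum is the bound that survives the induction. *)
    apply Rle_trans with (M / (1 - q) * (1 - q ^ S n)).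
    - induction n as [|n IH].
      + rewrite sum_O. eapply Rle_trans; [apply Hs|]. simpl. right. field. lra.
      + rewrite sum_Sn. eapply Rle_trans; [apply norm_triangle|].
        eapply Rle_trans; [apply Rplus_le_compat; [apply IH|apply Hs]|].
        simpl. right. field. lra.
    - pose proof (pow_le q (S n) (proj1 Hq)).
      assert (0 <= M / (1 - q)) by (apply Rdiv_le_0_compat; lra).
      nra. }
  assert (Hlim : is_lim_seq (fun n => norm (sum_n s n)) (norm l)).
  { eapply filterlim_comp; [exact Hl|apply filterlim_norm]. }
  apply (is_lim_seq_le _ (fun _ => M / (1 - q)) (norm l) (M / (1 - q)) Hpart Hlim).
  apply is_lim_seq_const.
Qed.

Lemma is_series_norm_bounded {K : AbsRing} {V : NormedModule K} (s : nat -> V) (l : V) :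
  is_series s l -> exists B, 0 <= B /\ forall n, norm (s n) <= B.
Proof.
  intros Hl.
  destruct (filterlim_bounded (sum_n s)) as [M HM]; [now exists l|].
  assert (0 <= M) by (pose proof (HM 0%nat); pose proof (norm_ge_0 (sum_n s 0)); lra).
  exists (M + M). split; [lra|]. intros [|n].
  - pose proof (HM 0%nat) as H0. rewrite sum_O in H0. lra.
  - replace (s (S n)) with (minus (sum_n s (S n)) (sum_n s n)).
    + eapply Rle_trans; [apply norm_triangle|]. rewrite norm_opp.
      apply Rplus_le_compat; apply HM.
    + rewrite sum_Sn, plus_comm. unfold minus. rewrite <- plus_assoc.
      etransitivity; [apply f_equal, plus_opp_r|apply plus_zero_r].
Qed.

Definition disk_series (a : nat -> C) (F : C -> C) : Prop :=
  forall z, unit_disk z -> is_series (fun n => (a n * z ^ n)%C) (F z).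

(** The terms of the convergent series at the real point [r] are bounded; this replaces Cauchy's
    estimate. *)
Lemma disk_series_coef_bound (a : nat -> C) (F : C -> C) (r : R) :
  disk_series a F -> 0 <= r < 1 ->
  exists B, 0 <= B /\ forall n, Cmod (a n) * r ^ n <= B.
Proof.
  intros Ha Hr.
  assert (Hd : unit_disk (RtoC r)) by (unfold unit_disk; rewrite Cmod_R, Rabs_pos_eq; lra).
  destruct (is_series_norm_bounded _ _ (Ha _ Hd)) as [B [HB HB']].
  exists B. split; [exact HB|]. intros n.
  specialize (HB' n). change (Cmod (a n * RtoC r ^ n)%C <= B) in HB'.
  rewrite Cmod_mult, Cmod_pow, Cmod_R, Rabs_pos_eq in HB'; lra.
Qed.

(** Since |a_k z^k| = |a_k| r^k (|z|/r)^k, the tail is dominated by a geometric one. The constant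
    [B] serves all [n] and [z] at once. *)
Lemma disk_series_tail (a : nat -> C) (F : C -> C) (r : R) :
  disk_series a F -> 0 < r < 1 ->
  exists B, 0 <= B /\ forall n z, Cmod z < r ->
    Cmod (F z - sum_n (fun k => (a k * z ^ k)%C) n) <=
    B * (Cmod z / r) ^ S n / (1 - Cmod z / r).
Proof.
  intros Ha Hr.
  destruct (disk_series_coef_bound a F r Ha) as [B [HB HaB]]; [lra|].
  exists B. split; [exact HB|]. intros n z Hz.
  pose proof (Cmod_ge_0 z) as Hz0.
  assert (Hq : 0 <= Cmod z / r < 1).
  { split; [apply Rdiv_le_0_compat; lra|].
    apply Rmult_lt_reg_r with r; [lra|]. field_simplify; lra. }
  apply (norm_series_geom (V := C_NormedModule) (fun k => (a (S n + k)%nat * z ^ (S n + k))%C) _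
           (B * (Cmod z / r) ^ S n) (Cmod z / r) Hq).
  - intros k. change (Cmod (a (S n + k)%nat * z ^ (S n + k))%C <=
      B * (Cmod z / r) ^ S n * (Cmod z / r) ^ k).
    rewrite Cmod_mult, Cmod_pow.
    rewrite Rmult_assoc, <- pow_add.
    replace (Cmod z ^ (S n + k)) with (r ^ (S n + k) * (Cmod z / r) ^ (S n + k)).
    + rewrite <- Rmult_assoc. apply Rmult_le_compat_r; [apply pow_le; lra|]. apply HaB.
    + rewrite <- Rpow_mult_distr. f_equal. field. lra.
  - apply (is_series_incr_n (fun k => (a k * z ^ k)%C) (S n)); [lia|].
    replace (plus _ _) with (F z).
    + apply Ha. unfold unit_disk. lra.
    + simpl pred. change (F z = (F z - sum_n (fun k : nat => (a k * z ^ k)%C) n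
        + sum_n (fun k : nat => (a k * z ^ k)%C) n)%C). ring.
Qed.

(* [ring] and [field] do not see that the carrier of [C_NormedModule] is [C]. *)
Ltac Ceq := lazymatch goal with |- ?x = ?y => change (@eq C x y) end.

(** * Termwise differentiation *)

Lemma Cmod_pow_deriv_le (z : C) (r R : R) (n : nat) :
  Cmod z <= r -> r < R ->
  Cmod (RtoC (INR n) * z ^ pred n) <= R ^ n / (R - r).
Proof.
  intros Hz HR.
  pose proof (Cmod_ge_0 z) as Hz0.
  rewrite Cmod_mult, Cmod_R, Cmod_pow, Rabs_pos_eq by apply pos_INR.
  apply Rmult_le_reg_r with (R - r); [lra|].
  replace (R ^ n / (R - r) * (R - r)) with (R ^ n) by (field; lra).
  (* The induction carries this sharper bound, through R^(n+1) - r^(n+1) = r (R^n - r^n) + R^n (R -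
     r). *)
  apply Rle_trans with (R ^ n - r ^ n);
    [|pose proof (pow_le r n (Rle_trans _ _ _ Hz0 Hz)); lra].
  induction n as [|n IH]; [simpl; lra|].
  rewrite S_INR. simpl pred.
  assert (Hp : Cmod z ^ n <= R ^ n) by (apply pow_incr; lra).
  assert (Hp' : Cmod z ^ n <= r ^ n) by (apply pow_incr; lra).
  assert (Hp0 : 0 <= Cmod z ^ n) by now apply pow_le.
  assert (Hn : INR n * Cmod z ^ n * (R - r) <= r * (R ^ n - r ^ n)).
  { destruct n as [|n]; [simpl; lra|].
    cbn [pred] in IH.
    replace (INR (S n) * Cmod z ^ S n * (R - r))
      with (Cmod z * (INR (S n) * Cmod z ^ n * (R - r))) by (simpl; ring).
    apply Rmult_le_compat; try lra.
    apply Rmult_le_pos; [|lra].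
    apply Rmult_le_pos; [apply pos_INR|now apply pow_le]. }
  replace (R ^ S n - r ^ S n) with (r * (R ^ n - r ^ n) + R ^ n * (R - r)) by (simpl; ring).
  nra.
Qed.

(** By induction: the remainder for n+1 is [w] times the remainder for n, plus n z^(n-1) (w - z)^2.
    The two pieces use up the summands of R = r + (R - r). *)
Lemma Cmod_pow_taylor_le (z w : C) (r R : R) (n : nat) :
  Cmod z <= r -> Cmod w <= r -> r < R ->
  Cmod (w ^ n - z ^ n - (w - z) * (RtoC (INR n) * z ^ pred n)) <=
  Cmod (w - z) ^ 2 / (R - r) ^ 2 * R ^ n.
Proof.
  intros Hz Hw HR.
  pose proof (Cmod_ge_0 w) as Hw0.
  pose proof (pow2_ge_0 (Cmod (w - z))) as Hh.
  assert (Hc : 0 <= Cmod (w - z) ^ 2 / (R - r) ^ 2)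
    by (apply Rdiv_le_0_compat; [exact Hh|apply pow_lt; lra]).
  induction n as [|n IH].
  - replace (w ^ 0 - z ^ 0 - (w - z) * (RtoC (INR 0) * z ^ pred 0))%C with (RtoC 0)
      by (simpl; ring).
    rewrite Cmod_0, pow_O, Rmult_1_r. exact Hc.
  - replace (w ^ S n - z ^ S n - (w - z) * (RtoC (INR (S n)) * z ^ pred (S n)))%C
      with (w * (w ^ n - z ^ n - (w - z) * (RtoC (INR n) * z ^ pred n)) +
            (w - z) * ((w - z) * (RtoC (INR n) * z ^ pred n)))%C.
    2:{ rewrite S_INR, RtoC_plus. destruct n as [|n]; simpl; ring. }
    eapply Rle_trans; [apply Cmod_triangle|]. rewrite !(Cmod_mult (w - z)), (Cmod_mult w).
    pose proof (Cmod_pow_deriv_le z r R n Hz HR) as Hd.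
    replace (Cmod (w - z) ^ 2 / (R - r) ^ 2 * R ^ S n) with
      (r * (Cmod (w - z) ^ 2 / (R - r) ^ 2 * R ^ n) +
       Cmod (w - z) ^ 2 * (R ^ n / (R - r))) by (simpl; field; lra).
    apply Rplus_le_compat.
    + apply Rmult_le_compat; try apply Cmod_ge_0; assumption.
    + rewrite <- Rmult_assoc. replace (Cmod (w - z) * Cmod (w - z)) with (Cmod (w - z) ^ 2) by ring.
      now apply Rmult_le_compat_l.
Qed.

(** * Linear operations and shifts of complex series *)

Lemma is_series_Cplus (s t : nat -> C) (k l : C) :
  is_series s k -> is_series t l -> is_series (fun n => (s n + t n)%C) (k + l)%C.
Proof. intros Hs Ht. exact (is_series_plus s t k l Hs Ht). Qed.

Lemma is_series_Cmult_l (c : C) (s : nat -> C) (l : C) :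
  is_series s l -> is_series (fun n => (c * s n)%C) (c * l)%C.
Proof. intros Hs. exact (is_series_scal c s l Hs). Qed.

Lemma is_series_Cshift (s : nat -> C) (l : C) :
  is_series s l -> is_series (fun n => match n with O => RtoC 0 | S m => s m end) l.
Proof.
  intros Hs. apply is_series_decr_1.
  replace (plus l _) with l; [exact Hs|].
  change (l = (l + - RtoC 0)%C). ring.
Qed.

Lemma is_series_Cminus (s t : nat -> C) (k l : C) :
  is_series s k -> is_series t l -> is_series (fun n => (s n - t n)%C) (k - l)%C.
Proof. intros Hs Ht. exact (is_series_minus s t k l Hs Ht). Qed.

Lemma C_derive_of_quadratic_remainder (F : C -> C) (z l : C) (d M : R) :
  0 < d ->
  (forall w, Cmod (w - z) < d -> Cmod (F w - F z - (w - z) * l) <= M * Cmod (w - z) ^ 2) ->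
  C_derive F z = l.
Proof.
  intros Hd HM. apply is_C_lim_unique.
  apply filterlim_locally. intros eps.
  (* [Rabs M + 1] is a positive denominator whatever the sign of [M]. *)
  assert (Hd' : 0 < Rmin d (eps / (Rabs M + 1))).
  { apply Rmin_pos; [lra|]. pose proof (Rabs_pos M).
    apply Rdiv_lt_0_compat; [apply eps|lra]. }
  apply (locally_le_locally_norm (V := C_NormedModule)).
  exists (mkposreal _ Hd'). intros w Hw Hne.
  change (Cmod (w - z) < Rmin d (eps / (Rabs M + 1))) in Hw.
  pose proof (Rlt_le_trans _ _ _ Hw (Rmin_l _ _)) as H1.
  pose proof (Rlt_le_trans _ _ _ Hw (Rmin_r _ _)) as H2.
  apply C_NormedModule_mixin_compat1.
  change (Cmod ((F w - F z) / (w - z) - l) < eps).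
  assert (Hwz : (w - z)%C <> RtoC 0) by (now apply Cminus_eq_contra).
  pose proof (proj1 (Cmod_gt_0 _) Hwz) as Hpos.
  replace ((F w - F z) / (w - z) - l)%C with ((F w - F z - (w - z) * l) / (w - z))%C
    by (field; exact Hwz).
  rewrite Cmod_div by exact Hwz.
  apply Rmult_lt_reg_r with (Cmod (w - z)); [exact Hpos|].
  unfold Rdiv. rewrite Rmult_assoc, Rinv_l, Rmult_1_r by lra.
  eapply Rle_lt_trans; [now apply HM|].
  pose proof (Rle_abs M). pose proof (Rabs_pos M).
  assert (H3 : (Rabs M + 1) * Cmod (w - z) < eps).
  { apply Rmult_lt_compat_l with (r := Rabs M + 1) in H2; [|lra].
    replace ((Rabs M + 1) * (eps / (Rabs M + 1))) with (pos eps) in H2 by (field; lra).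
    exact H2. }
  simpl. nra.
Qed.

(** The differentiated series converges geometrically. Summing the quadratic remainders of the
    powers bounds that of [F] by a multiple of |w - z|^2, which identifies the limit of the
    difference quotients. *)
Lemma disk_series_C_derive (a : nat -> C) (F : C -> C) :
  disk_series a F ->
  disk_series (fun n => (RtoC (INR (S n)) * a (S n))%C) (C_derive F).
Proof.
  intros Ha z Hz. unfold unit_disk in Hz.
  pose proof (Cmod_ge_0 z) as Hz0.
  (* Equally spaced radii |z| < r < R < R' < 1: [w] stays within [r], the estimates on powers use
     [R], the coefficient bound uses [R'], and q = R/R' is the geometric ratio. *)
  set (r := (1 + 3 * Cmod z) / 4). set (R := (1 + Cmod z) / 2). set (R' := (3 + Cmod z) / 4).
  destruct (disk_series_coef_bound a F R' Ha) as [B [HB HaB]]; [unfold R'; lra|].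
  set (q := R / R').
  assert (Hq : 0 <= q < 1).
  { unfold q. split; [apply Rdiv_le_0_compat; unfold R, R'; lra|].
    apply Rmult_lt_reg_r with R'; [unfold R'; lra|].
    unfold Rdiv. rewrite Rmult_assoc, Rinv_l; unfold R, R'; lra. }
  assert (HaR : forall n, Cmod (a n) * R ^ n <= B * q ^ n).
  { intros n. replace (R ^ n) with (R' ^ n * q ^ n).
    - rewrite <- Rmult_assoc. apply Rmult_le_compat_r; [apply pow_le; lra|apply HaB].
    - rewrite <- Rpow_mult_distr. f_equal. unfold q. field. unfold R'; lra. }
  set (D := fun n => (a n * (RtoC (INR n) * z ^ pred n))%C).
  assert (HD : ex_series D).
  { apply (ex_series_le (V := C_CompleteNormedModule) D (fun n => B / (R - r) * q ^ n)).
    - intros n. change (Cmod (D n) <= B / (R - r) * q ^ n). unfold D. rewrite Cmod_mult.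
      eapply Rle_trans; [apply Rmult_le_compat_l; [apply Cmod_ge_0|]|].
      + apply (Cmod_pow_deriv_le z r R n); unfold r, R; lra.
      + specialize (HaR n).
        apply Rmult_le_reg_r with (R - r); [unfold R, r; lra|].
        replace (B / (R - r) * q ^ n * (R - r)) with (B * q ^ n) by (field; unfold R, r; lra).
        replace (Cmod (a n) * (R ^ n / (R - r)) * (R - r)) with (Cmod (a n) * R ^ n)
          by (field; unfold R, r; lra).
        exact HaR.
    - apply (ex_series_scal_l (B / (R - r)) (fun n => q ^ n)).
      apply ex_series_geom. rewrite Rabs_pos_eq; lra. }
  destruct HD as [l Hl].
  replace (C_derive F z) with l.
  - assert (Hl' : is_series D (plus l (D 0%nat))).
    (* The term of index 0 carries the factor [INR 0], so dropping it keeps the sum. *)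
    { replace (plus l (D 0%nat)) with l; [exact Hl|].
      replace (D 0%nat) with (zero (G := C_NormedModule)); [symmetry; apply plus_zero_r|].
      change (RtoC 0 = D 0%nat). unfold D. simpl. ring. }
    apply is_series_incr_1 in Hl'. revert Hl'. apply is_series_ext.
    intros n. unfold D. simpl pred. Ceq; ring.
  - symmetry.
    apply (C_derive_of_quadratic_remainder F z l (r - Cmod z) (B / (R - r) ^ 2 / (1 - q)));
      [unfold r; lra|].
    intros w Hw.
    assert (Hwr : Cmod w <= r).
    { replace w with ((w - z) + z)%C by ring.
      eapply Rle_trans; [apply Cmod_triangle|]. lra. }
    apply Rle_trans with (B * (Cmod (w - z) ^ 2 / (R - r) ^ 2) / (1 - q));
      [|right; field; unfold R, r; lra].
    apply (norm_series_geom (V := C_NormedModule)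
      (fun n => (a n * w ^ n - a n * z ^ n - (w - z) * D n)%C) _ _ q Hq).
    + intros n. change (Cmod (a n * w ^ n - a n * z ^ n - (w - z) * D n)%C <=
        B * (Cmod (w - z) ^ 2 / (R - r) ^ 2) * q ^ n).
      unfold D.
      replace (a n * w ^ n - a n * z ^ n - (w - z) * (a n * (RtoC (INR n) * z ^ pred n)))%C
        with (a n * (w ^ n - z ^ n - (w - z) * (RtoC (INR n) * z ^ pred n)))%C by ring.
      rewrite Cmod_mult.
      eapply Rle_trans; [apply Rmult_le_compat_l; [apply Cmod_ge_0|]|].
      * apply (Cmod_pow_taylor_le z w r R n); unfold r, R in *; lra.
      * specialize (HaR n).
        assert (0 <= Cmod (w - z) ^ 2 / (R - r) ^ 2)
          by (apply Rdiv_le_0_compat; [apply pow2_ge_0|apply pow_lt; unfold R, r; lra]).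
        nra.
    + apply is_series_Cminus; [apply is_series_Cminus|].
      * apply Ha. unfold unit_disk, r in *; lra.
      * apply Ha. exact Hz.
      * now apply is_series_Cmult_l.
Qed.

(** Multiplication by [z] shifts the coefficients by one place, and the product is F - zF +
    z(zF). *)
Lemma disk_series_quadratic_mult (d : nat -> C) (F : C -> C) :
  disk_series d F ->
  disk_series (fun n => match n with
                        | O => d O
                        | S O => (d 1%nat - d O)%C
                        | S (S m as k) => (d (S k) - d k + d m)%C
                        end)
    (fun z => ((1 - z + z * z) * F z)%C).
Proof.
  intros Hd z Hz. specialize (Hd z Hz).
  pose proof (is_series_Cshift _ _ (is_series_Cmult_l z _ _ Hd)) as H1.
  pose proof (is_series_Cshift _ _ (is_series_Cmult_l z _ _ H1)) as H2.
  pose proof (is_series_Cplus _ _ _ _ (is_series_Cminus _ _ _ _ Hd H1) H2) as H.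
  replace ((1 - z + z * z) * F z)%C with (F z - z * F z + z * (z * F z))%C by ring.
  revert H. apply is_series_ext.
  intros [|[|n]]; simpl; Ceq; ring.
Qed.

(** * Averages over roots of unity *)

Lemma Csum_S (s : nat -> C) (n : nat) : sum_n s (S n) = (sum_n s n + s (S n))%C.
Proof. exact (sum_Sn s n). Qed.

Lemma Csum_mult_l (c : C) (s : nat -> C) (n : nat) :
  sum_n (fun k => (c * s k)%C) n = (c * sum_n s n)%C.
Proof. exact (sum_n_mult_l (K := C_Ring) c s n). Qed.

Lemma Csum_mult_r (c : C) (s : nat -> C) (n : nat) :
  sum_n (fun k => (s k * c)%C) n = (sum_n s n * c)%C.
Proof. exact (sum_n_mult_r (K := C_Ring) c s n). Qed.

Lemma Csum_conj (s : nat -> C) (n : nat) :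
  Cconj (sum_n s n) = sum_n (fun k => Cconj (s k)) n.
Proof.
  induction n as [|n IH]; [now rewrite !sum_O|].
  now rewrite !Csum_S, Cplus_conj, IH.
Qed.

Lemma Csum_Re (s : nat -> C) (n : nat) : Re (sum_n s n) = sum_n (fun k => Re (s k)) n.
Proof.
  induction n as [|n IH]; [now rewrite !sum_O|].
  rewrite Csum_S, re_plus, IH, sum_Sn. reflexivity.
Qed.

Definition cis (t : R) : C := (cos t, sin t).

Lemma cis_pow (t : R) (n : nat) : (cis t ^ n)%C = cis (INR n * t).
Proof.
  induction n as [|n IH].
  - unfold cis. simpl INR. rewrite Rmult_0_l, cos_0, sin_0. reflexivity.
  - rewrite Cpow_S, IH, S_INR, Rmult_plus_distr_r, Rmult_1_l.
    unfold cis. rewrite cos_plus, sin_plus. apply injective_projections; simpl; ring.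
Qed.

Lemma Cmod_cis (t : R) : Cmod (cis t) = 1.
Proof.
  unfold Cmod, cis. simpl fst. simpl snd.
  pose proof (sin2_cos2 t) as H. unfold Rsqr in H.
  replace (cos t ^ 2 + sin t ^ 2) with 1 by (simpl; lra). apply sqrt_1.
Qed.

Lemma cis_neq_1 (t : R) : 0 < t < 2 * PI -> cis t <> RtoC 1.
Proof.
  intros Ht H. apply (f_equal fst) in H. simpl in H.
  replace t with (2 * (t / 2)) in H by field.
  rewrite cos_2a_sin in H.
  assert (0 < sin (t / 2)) by (apply sin_gt_0; lra). nra.
Qed.

Definition unity_root (M : nat) : C := cis (2 * PI / INR (S M)).

Lemma Cmod_unity_root (M : nat) : Cmod (unity_root M) = 1.
Proof. apply Cmod_cis. Qed.

Lemma unity_root_pow_period (M : nat) : (unity_root M ^ S M)%C = RtoC 1.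
Proof.
  unfold unity_root. rewrite cis_pow.
  replace (INR (S M) * (2 * PI / INR (S M))) with (2 * PI)
    by (field; apply not_0_INR; discriminate).
  unfold cis. now rewrite cos_2PI, sin_2PI.
Qed.

Lemma unity_root_pow_neq_1 (M m : nat) :
  (0 < m <= M)%nat -> (unity_root M ^ m)%C <> RtoC 1.
Proof.
  intros Hm. unfold unity_root. rewrite cis_pow. apply cis_neq_1.
  assert (0 < INR m) by (apply lt_0_INR; lia).
  assert (INR m < INR (S M)) by (apply lt_INR; lia).
  pose proof PI_RGT_0.
  split.
  - apply Rmult_lt_0_compat; [lra|]. apply Rdiv_lt_0_compat; lra.
  - replace (INR m * (2 * PI / INR (S M))) with (2 * PI * (INR m / INR (S M))) by (field; lra).
    rewrite <- (Rmult_1_r (2 * PI)) at 2. apply Rmult_lt_compat_l; [lra|].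
    apply Rmult_lt_reg_r with (INR (S M)); [lra|]. field_simplify; lra.
Qed.

Lemma Csum_geom (x : C) (n : nat) : ((1 - x) * sum_n (fun k => x ^ k) n = 1 - x ^ S n)%C.
Proof.
  induction n as [|n IH]; [rewrite sum_O; simpl; ring|].
  rewrite Csum_S, Cmult_plus_distr_l, IH, (Cpow_S x (S n)). ring.
Qed.

Lemma Cconj_unit_mult (z : C) : Cmod z = 1 -> (z * Cconj z)%C = RtoC 1.
Proof. intros Hz. rewrite <- Cmod2_conj, Hz. f_equal. ring. Qed.

(** The summand is a power x^j of x = w^a conj(w)^b, and x^(M+1) = 1. For a <> b the geometric sum
    therefore vanishes as soon as x <> 1. *)
Lemma unity_root_orthogonal (M a b : nat) :
  (a <= M)%nat -> (b <= M)%nat ->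
  sum_n (fun j => ((unity_root M ^ j) ^ a * Cconj ((unity_root M ^ j) ^ b))%C) M =
  if Nat.eqb a b then RtoC (INR (S M)) else RtoC 0.
Proof.
  intros Ha Hb.
  set (w := unity_root M). set (x := (w ^ a * Cconj w ^ b)%C).
  assert (Hww : (w * Cconj w)%C = RtoC 1) by apply Cconj_unit_mult, Cmod_unity_root.
  assert (Hpow : forall n, (w ^ n * Cconj w ^ n)%C = RtoC 1)
    by (intros n; now rewrite <- Cpow_mult_l, Hww, Cpow_1_l).
  rewrite (sum_n_ext _ (fun j => (x ^ j)%C)).
  2:{ intros j. unfold x.
      rewrite !Cpow_conj, Cpow_mult_l, <- !Cpow_mult_r. now rewrite !(Nat.mul_comm j). }
  destruct (Nat.eqb_spec a b) as [<-|Hab].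
  - rewrite (sum_n_ext _ (fun _ => RtoC 1)).
    2:{ intros j. unfold x. now rewrite Hpow, Cpow_1_l. }
    clear. induction M as [|M IH]; [now rewrite sum_O|].
    now rewrite Csum_S, IH, (S_INR (S M)), RtoC_plus.
  - assert (Hx : (1 - x)%C <> RtoC 0).
    (* Cancelling the common powers by w conj(w) = 1 would give w^|a-b| = 1 with 0 < |a-b| <= M. *)
    { apply Cminus_eq_contra. intros Hx. unfold x in Hx.
      destruct (Nat.lt_total a b) as [Hlt|[Heq|Hlt]]; [|now apply Hab|].
      - apply (unity_root_pow_neq_1 M (b - a)); [lia|]. fold w.
        replace b with (a + (b - a))%nat in Hx by lia.
        rewrite Cpow_add_r, Cmult_assoc, Hpow, Cmult_1_l in Hx.
        rewrite <- (Hpow (b - a)%nat), <- Hx. ring.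
      - apply (unity_root_pow_neq_1 M (a - b)); [lia|]. fold w.
        replace a with (b + (a - b))%nat in Hx by lia.
        rewrite Cpow_add_r in Hx.
        transitivity (w ^ b * Cconj w ^ b * w ^ (a - b))%C; [rewrite Hpow; ring|].
        rewrite Hx. ring. }
    pose proof (Csum_geom x M) as Hg.
    assert (HxM : (x ^ S M)%C = RtoC 1).
    { unfold x.
      rewrite Cpow_mult_l, <- !Cpow_mult_r, (Nat.mul_comm a), (Nat.mul_comm b), !Cpow_mult_r.
      rewrite <- Cpow_conj. unfold w. rewrite unity_root_pow_period.
      replace (Cconj 1) with (RtoC 1) by (unfold Cconj; simpl; now rewrite Ropp_0).
      rewrite !Cpow_1_l. ring. }
    rewrite HxM in Hg.
    replace (sum_n _ M) with (/ (1 - x) * ((1 - x) * sum_n (fun k => (x ^ k)%C) M))%C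
      by (Ceq; field; exact Hx).
    rewrite Hg. Ceq; ring.
Qed.

Definition Cpoly (c : nat -> C) (d : nat) (z : C) : C := sum_n (fun k => (c k * z ^ k)%C) d.

(* The Fourier coefficient of order [-n] of [|q|^2] on the unit circle. *)
Definition sqr_fourier (q : nat -> C) (d n : nat) : C :=
  sum_n (fun k => sum_n (fun l =>
    if Nat.eqb (n + k) l then (q k * Cconj (q l))%C else RtoC 0) d) d.

(** On the circle |q|^2 has no frequency above its degree [d], so the Toeplitz form does not see
    coefficients of [p] beyond [d]. *)
Lemma sqr_fourier_0 (q : nat -> C) (d n : nat) : (d < n)%nat -> sqr_fourier q d n = RtoC 0.
Proof.
  intros Hn. unfold sqr_fourier.
  assert (Hz : sum_n (fun _ => RtoC 0) d = RtoC 0) by apply (sum_n_m_const_zero (G := C_Ring) 0 d).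
  transitivity (sum_n (fun _ => RtoC 0) d); [|exact Hz]. apply sum_n_ext. intros k.
  transitivity (sum_n (fun _ => RtoC 0) d); [|exact Hz]. apply sum_n_ext_loc. intros l Hl.
  destruct (Nat.eqb_spec (n + k) l); [lia|reflexivity].
Qed.

(** Expanding |q|^2 leaves only orthogonality sums. The bound n + d <= M keeps every exponent in the
    range where distinct powers are orthogonal, so there is no aliasing. *)
Lemma sum_sqr_fourier (q : nat -> C) (d n M : nat) :
  (n + d <= M)%nat ->
  sum_n (fun j => let z := (unity_root M ^ j)%C in
    (z ^ n * (Cpoly q d z * Cconj (Cpoly q d z)))%C) M =
  (RtoC (INR (S M)) * sqr_fourier q d n)%C.
Proof.
  intros HM. cbv zeta. unfold sqr_fourier.
  rewrite <- Csum_mult_l.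
  rewrite (sum_n_ext _ (fun j => sum_n (fun k => sum_n (fun l =>
    (q k * Cconj (q l) *
     ((unity_root M ^ j) ^ (n + k) * Cconj ((unity_root M ^ j) ^ l)))%C) d) d)).
  2:{ intros j. unfold Cpoly. rewrite Csum_conj, <- Csum_mult_r, <- Csum_mult_l.
      apply sum_n_ext. intros k. rewrite <- !Csum_mult_l.
      apply sum_n_ext. intros l. rewrite Cmult_conj, Cpow_add_r. Ceq; ring. }
  rewrite sum_n_switch. apply sum_n_ext_loc. intros k Hk.
  rewrite sum_n_switch, <- Csum_mult_l. apply sum_n_ext_loc. intros l Hl.
  rewrite Csum_mult_l, unity_root_orthogonal by lia.
  destruct (Nat.eqb (n + k) l); Ceq; ring.
Qed.

Lemma sum_poly_sqr_fourier (c q : nat -> C) (K d M : nat) :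
  (K + d <= M)%nat ->
  sum_n (fun j => let z := (unity_root M ^ j)%C in
    (Cpoly c K z * (Cpoly q d z * Cconj (Cpoly q d z)))%C) M =
  (RtoC (INR (S M)) * sum_n (fun n => (c n * sqr_fourier q d n)%C) K)%C.
Proof.
  intros HM. cbv zeta.
  rewrite (sum_n_ext _ (fun j => sum_n (fun n => let z := (unity_root M ^ j)%C in
    (c n * (z ^ n * (Cpoly q d z * Cconj (Cpoly q d z))))%C) K)).
  2:{ intros j. unfold Cpoly at 1. rewrite <- Csum_mult_r.
      apply sum_n_ext. intros n. cbv zeta. Ceq; ring. }
  rewrite sum_n_switch, <- Csum_mult_l. apply sum_n_ext_loc. intros n Hn.
  cbv zeta. rewrite Csum_mult_l, sum_sqr_fourier by lia. Ceq; ring.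
Qed.

(** * Positivity of Toeplitz forms *)

Lemma Re_mult_sqr (p z : C) : Re (p * (z * Cconj z)) = Re p * Cmod z ^ 2.
Proof. rewrite <- Cmod2_conj. apply re_scal_r. Qed.

(** The pointwise inequality is weighted by |q|^2 >= 0 and summed over the roots of unity; the mean
    of |q|^2 itself is [sqr_fourier q d 0]. *)
Lemma poly_toeplitz_ge (c q : nat -> C) (K d : nat) (eps : R) :
  (forall z, Cmod z = 1 -> - eps <= Re (Cpoly c K z)) ->
  - eps * Re (sqr_fourier q d 0) <= Re (sum_n (fun n => (c n * sqr_fourier q d n)%C) K).
Proof.
  intros Hc. set (M := (K + d)%nat).
  assert (HN : 0 < INR (S M)) by (apply lt_0_INR; lia).
  apply Rmult_le_reg_l with (INR (S M)); [exact HN|].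
  rewrite <- (re_scal_l (INR (S M))), <- (sum_poly_sqr_fourier c q K d M) by lia.
  replace (INR (S M) * (- eps * Re (sqr_fourier q d 0)))
    with (- eps * Re (RtoC (INR (S M)) * sqr_fourier q d 0)%C) by (rewrite re_scal_l; ring).
  rewrite <- (sum_sqr_fourier q d 0 M) by lia.
  rewrite <- re_scal_l, <- Csum_mult_l, !Csum_Re.
  unfold sum_n. apply sum_n_m_le. intros j. cbv zeta.
  rewrite Re_mult_sqr, re_scal_l, Re_mult_sqr.
  rewrite <- Rmult_assoc. apply Rmult_le_compat_r; [apply pow2_ge_0|].
  replace (Re ((unity_root M ^ j) ^ 0)) with 1 by reflexivity.
  rewrite Rmult_1_r. apply Hc. now rewrite Cmod_pow, Cmod_unity_root, pow1.
Qed.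

Lemma is_lim_seq_sum_n (u : nat -> nat -> R) (l : nat -> R) (d : nat) :
  (forall n, is_lim_seq (fun m => u m n) (l n)) ->
  is_lim_seq (fun m => sum_n (u m) d) (sum_n l d).
Proof.
  intros Hu. induction d as [|d IH].
  - rewrite sum_O. apply is_lim_seq_ext with (fun m => u m 0%nat); [|apply Hu].
    intros m. now rewrite sum_O.
  - rewrite sum_Sn. apply is_lim_seq_ext with (fun m => sum_n (u m) d + u m (S d)).
    + intros m. now rewrite sum_Sn.
    + now apply is_lim_seq_plus'.
Qed.

(** For the dilated coefficients c_n r^n, a truncation at large order has real part at least -eps on
    the circle with eps as small as desired, while the Toeplitz form stays the same. Then r tends to
    1. *)
Lemma caratheodory_toeplitz (c q : nat -> C) (p : C -> C) (d : nat) :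
  disk_series c p -> (forall z, unit_disk z -> 0 <= Re (p z)) ->
  0 <= Re (sum_n (fun n => (c n * sqr_fourier q d n)%C) d).
Proof.
  intros Hc Hp.
  assert (Hr : forall r, 0 < r < 1 ->
    0 <= Re (sum_n (fun n => (c n * r ^ n * sqr_fourier q d n)%C) d)).
  { intros r Hr. apply Rnot_lt_le. intros Hneg.
    set (A := Re (sum_n _ d)) in Hneg.
    set (T := Re (sqr_fourier q d 0)).
    (* The tail is compared at a radius strictly between [r] and 1; [s] is the resulting ratio. *)
    destruct (disk_series_tail c p ((1 + r) / 2) Hc) as [B [HB Htail]]; [lra|].
    set (s := r / ((1 + r) / 2)) in *.
    assert (Hs : 0 < s < 1).
    { unfold s. split; [apply Rdiv_lt_0_compat; lra|].
      apply Rmult_lt_reg_r with ((1 + r) / 2); [lra|].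
      unfold Rdiv at 1. rewrite Rmult_assoc, Rinv_l; lra. }
    (* Once s^(K+1) is below this threshold, eps * T < -A, which contradicts -eps * T <= A < 0. The
       added ones keep the denominators positive. *)
    assert (Heps : 0 < - A / (Rabs T + 1) * (1 - s) / (B + 1)).
    { pose proof (Rabs_pos T). apply Rdiv_lt_0_compat; [|lra].
      apply Rmult_lt_0_compat; [apply Rdiv_lt_0_compat|]; lra. }
    destruct (pow_lt_1_zero s (Rabs_def1 s 1 ltac:(lra) ltac:(lra)) _ Heps) as [N HN].
    set (K := (N + d)%nat).
    specialize (HN (S K) ltac:(unfold K; lia)).
    rewrite Rabs_pos_eq in HN by (apply pow_le; lra).
    set (eps := B * s ^ S K / (1 - s)).
    pose proof (pow_le s (S K) (Rlt_le _ _ (proj1 Hs))) as HsK.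
    assert (Hpoly : forall z, Cmod z = 1 ->
      - eps <= Re (Cpoly (fun n => (c n * r ^ n)%C) K z)).
    { intros z Hz.
      assert (Hrz : Cmod (r * z) = r) by (rewrite Cmod_mult, Cmod_R, Hz, Rabs_pos_eq; lra).
      specialize (Htail K (r * z)%C). rewrite Hrz in Htail.
      specialize (Htail ltac:(lra)).
      specialize (Hp (r * z)%C ltac:(unfold unit_disk; lra)).
      replace (Cpoly (fun n => (c n * r ^ n)%C) K z)
        with (sum_n (fun k => (c k * (r * z) ^ k)%C) K).
      2:{ apply sum_n_ext. intros n. rewrite Cpow_mult_l. Ceq; ring. }
      set (P := sum_n _ K) in *.
      pose proof (re_le_Cmod (p (r * z)%C - P)) as Hre.
      unfold Cminus in Hre. rewrite re_plus, re_opp in Hre.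
      apply Rabs_le_between in Hre. fold s in Htail. fold eps in Htail.
      unfold Cminus in Htail. lra. }
    pose proof (poly_toeplitz_ge _ q K d eps Hpoly) as H.
    (* The terms of index above [d] vanish by [sqr_fourier_0]. *)
    replace (Re (sum_n _ K)) with A in H.
    2:{ unfold A. f_equal. unfold K. clear.
        induction N as [|N IH]; [reflexivity|].
        rewrite Nat.add_succ_l, Csum_S, <- IH, sqr_fourier_0, Cmult_0_r by lia.
        symmetry. apply Cplus_0_r. }
    fold T in H.
    assert (HT : eps * T < - A).
    { pose proof (Rle_abs T). pose proof (Rabs_pos T).
      assert (He0 : 0 <= eps) by (unfold eps; apply Rdiv_le_0_compat; [|lra]; nra).
      apply Rle_lt_trans with (eps * (Rabs T + 1)); [nra|].
      apply Rle_lt_trans with ((B + 1) * s ^ S K / (1 - s) * (Rabs T + 1)).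
      - apply Rmult_le_compat_r; [lra|]. unfold eps, Rdiv.
        apply Rmult_le_compat_r; [left; apply Rinv_0_lt_compat; lra|]. nra.
      - apply Rmult_lt_compat_r with (r := (B + 1) / (1 - s) * (Rabs T + 1)) in HN.
        2:{ apply Rmult_lt_0_compat; [apply Rdiv_lt_0_compat|]; lra. }
        replace ((B + 1) * s ^ S K / (1 - s) * (Rabs T + 1))
          with (s ^ S K * ((B + 1) / (1 - s) * (Rabs T + 1))) by (field; lra).
        eapply Rlt_le_trans; [exact HN|]. right. field. lra. }
    lra. }
  (* The radii 1 - 1/(m+2) lie in [1/2, 1) and tend to 1. *)
  assert (Hlim : is_lim_seq
    (fun m => Re (sum_n (fun n => (c n * RtoC (1 - / INR (m + 2)) ^ n * sqr_fourier q d n)%C) d))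
    (Re (sum_n (fun n => (c n * sqr_fourier q d n)%C) d))).
  { assert (H1 : is_lim_seq (fun m => 1 - / INR (m + 2)) 1).
    { replace (Finite 1) with (Rbar_minus 1 0) by (simpl; f_equal; ring).
      apply is_lim_seq_minus'; [apply is_lim_seq_const|].
      apply (is_lim_seq_incr_n (fun m => / INR m) 2).
      replace (Finite 0) with (Rbar_inv p_infty) by reflexivity.
      apply is_lim_seq_inv; [apply is_lim_seq_INR|discriminate]. }
    assert (Hpow : forall n, is_lim_seq (fun m => (1 - / INR (m + 2)) ^ n) 1).
    { intros n. induction n as [|n IH]; [apply is_lim_seq_const|].
      replace (Finite 1) with (Finite (1 * 1)) by (f_equal; ring).
      now apply is_lim_seq_mult'. }
    assert (Hterm : forall n, is_lim_seq
      (fun m => Re (c n * RtoC (1 - / INR (m + 2)) ^ n * sqr_fourier q d n))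
      (Re (c n * sqr_fourier q d n))).
    { intros n.
      apply is_lim_seq_ext with (fun m => (1 - / INR (m + 2)) ^ n * Re (c n * sqr_fourier q d n)).
      - intros m. rewrite <- re_scal_l, RtoC_pow. f_equal. ring.
      - replace (Finite (Re _)) with (Finite (1 * Re (c n * sqr_fourier q d n))) by (f_equal; ring).
        apply is_lim_seq_mult'; [apply Hpow|apply is_lim_seq_const]. }
    rewrite Csum_Re.
    eapply is_lim_seq_ext; [intros m; symmetry; apply Csum_Re|].
    apply (is_lim_seq_sum_n (fun m n =>
      Re (c n * RtoC (1 - / INR (m + 2)) ^ n * sqr_fourier q d n))).
    exact Hterm. }
  assert (H0 : Rbar_le 0 (Re (sum_n (fun n => (c n * sqr_fourier q d n)%C) d))).
  { eapply is_lim_seq_le; [|apply is_lim_seq_const|exact Hlim].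
    intros m. apply Hr.
    assert (2 <= INR (m + 2)) by (rewrite plus_INR; pose proof (pos_INR m); simpl; lra).
    assert (0 < / INR (m + 2)) by (apply Rinv_0_lt_compat; lra).
    assert (/ INR (m + 2) <= / 2) by (apply Rinv_le_contravar; lra).
    lra. }
  exact H0.
Qed.

(** * Schur parameters *)

Lemma Re_plus_conj_minus (a b : C) :
  Re ((a + b) * Cconj (a - b)) = Cmod a ^ 2 - Cmod b ^ 2.
Proof.
  rewrite !Cmod2_alt. destruct a as [a1 a2], b as [b1 b2]. simpl. ring.
Qed.

(** The three moduli on the left are the entries of the Toeplitz matrix of w(z)/z applied to (u0,
    u1, u2). Stating the condition on coefficients avoids constructing [w]. *)
Definition toeplitz_contraction (b1 b2 b3 : C) : Prop :=
  forall u0 u1 u2 : C,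
  Cmod (b1 * u0) ^ 2 + Cmod (b2 * u0 + b1 * u1) ^ 2 +
    Cmod (b3 * u0 + b2 * u1 + b1 * u2) ^ 2 <=
  Cmod u0 ^ 2 + Cmod u1 ^ 2 + Cmod u2 ^ 2.

(* For [p = (1 + w) / (1 - w)] with [w = b1 z + b2 z^2 + b3 z^3 + ...], let [P]
   and [W] be the lower triangular Toeplitz matrices of [p] and [w], so that
   [P (1 - W) = 1 + W].  The Toeplitz form at [q = (1 - W) u] is then
   [Re <(1 + W) u, (1 - W) u> = |u|^2 - |W u|^2]. *)
Lemma caratheodory_toeplitz_contraction (b1 b2 b3 : C) (c : nat -> C) (p : C -> C) :
  disk_series c p -> (forall z, unit_disk z -> 0 <= Re (p z)) ->
  c 0%nat = RtoC 1 -> c 1%nat = (2 * b1)%C -> c 2%nat = (2 * b2 + 2 * b1 * b1)%C ->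
  c 3%nat = (2 * b3 + 4 * b1 * b2 + 2 * b1 * b1 * b1)%C ->
  toeplitz_contraction b1 b2 b3.
Proof.
  intros Hc Hp H0 H1 H2 H3 u0 u1 u2.
  set (v1 := (b1 * u0)%C). set (v2 := (b2 * u0 + b1 * u1)%C).
  set (v3 := (b3 * u0 + b2 * u1 + b1 * u2)%C).
  (* With u = (u0, u1, u2, 0) and W u = (0, v1, v2, v3), this is (1 - W) u. *)
  set (q := fun n : nat => match n with
    | 0 => u0 | 1 => (u1 - v1)%C | 2 => (u2 - v2)%C | _ => (0 - v3)%C end).
  pose proof (caratheodory_toeplitz c q p 3 Hc Hp) as H.
  replace (sum_n _ 3) with
    ((u0 + 0) * Cconj (u0 - 0) + (u1 + v1) * Cconj (u1 - v1) + (u2 + v2) * Cconj (u2 - v2) +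
     (0 + v3) * Cconj (0 - v3))%C in H.
  - rewrite !re_plus, !Re_plus_conj_minus, Cmod_0 in H. lra.
  - unfold sqr_fourier. repeat (rewrite !Csum_S || rewrite !sum_O). cbn [Nat.eqb Nat.add q].
    rewrite H0, H1, H2, H3.
    replace (u0 - 0)%C with u0 by ring.
    (* Each conjugate has the same coefficient on both sides, namely an entry of P (1 - W) u = (1 +
       W) u, so the conjugates may be free variables. *)
    generalize (Cconj u0) (Cconj (u1 - v1)) (Cconj (u2 - v2)) (Cconj (0 - v3)).
    intros d0 d1 d2 d3. unfold v1, v2, v3. Ceq; ring.
Qed.

(** Test vector (0, 0, 1). *)
Lemma schur_b1_le (b1 b2 b3 : C) : toeplitz_contraction b1 b2 b3 -> Cmod b1 <= 1.
Proof.
  intros contraction.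
  pose proof (contraction 0 0 1) as H.
  replace (b1 * 0)%C with (RtoC 0) in H by ring.
  replace (b2 * 0 + 0)%C with (RtoC 0) in H by ring.
  replace (b3 * 0 + b2 * 0 + b1 * 1)%C with b1 in H by ring.
  rewrite Cmod_0, Cmod_1 in H. pose proof (Cmod_ge_0 b1). nra.
Qed.

(** The first column (b1, b2, b3) has norm at most 1, and [b1] already exhausts it. *)
Lemma schur_b1_extremal (b1 b2 b3 : C) :
  toeplitz_contraction b1 b2 b3 -> Cmod b1 = 1 -> b2 = RtoC 0 /\ b3 = RtoC 0.
Proof.
  intros contraction Hb. pose proof (contraction 1 0 0) as H.
  replace (b1 * 1)%C with b1 in H by ring.
  replace (b2 * 1 + b1 * 0)%C with b2 in H by ring.
  replace (b3 * 1 + b2 * 0 + b1 * 0)%C with b3 in H by ring.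
  rewrite Cmod_0, Cmod_1, Hb in H.
  pose proof (Cmod_ge_0 b2). pose proof (Cmod_ge_0 b3).
  split; apply Cmod_eq_0; nra.
Qed.

(* The first two steps of the Schur algorithm. *)
Lemma schur_parameters (b1 b2 b3 : C) :
  toeplitz_contraction b1 b2 b3 -> Cmod b1 < 1 ->
  exists y t : C,
    b2 = (RtoC (1 - Cmod b1 ^ 2) * y)%C /\
    b3 = (RtoC (1 - Cmod b1 ^ 2) * (t - Cconj b1 * y * y))%C /\
    Cmod y <= 1 /\ Cmod t <= 1 - Cmod y ^ 2.
Proof.
  intros contraction Hb. set (D := 1 - Cmod b1 ^ 2).
  pose proof (Cmod_ge_0 b1) as Hb0.
  assert (HD : 0 < D) by (unfold D; nra).
  assert (HDc : RtoC D <> RtoC 0) by (intros H; apply RtoC_inj in H; lra).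
  set (y := (b2 / RtoC D)%C). set (t := (b3 / RtoC D + Cconj b1 * y * y)%C).
  assert (E2 : b2 = (RtoC D * y)%C) by (unfold y; field; exact HDc).
  assert (E3 : b3 = (RtoC D * (t - Cconj b1 * y * y))%C) by (unfold t; field; exact HDc).
  assert (Hbb : (b1 * Cconj b1)%C = (1 - RtoC D)%C).
  { rewrite <- Cmod2_conj. unfold D. rewrite RtoC_minus. ring. }
  (* This is the contraction property of the next Schur step, with first column (y, t), tested at
     (1, v). The vector chosen below makes the third image equal to t + y v, and then [D] factors
     out of the inequality. *)
  assert (Hv : forall v, Cmod (t + y * v) ^ 2 <= 1 - Cmod y ^ 2 + Cmod v ^ 2).
  { intros v.
    pose proof (contraction 1 (Cconj b1 * y + v)%C (Cconj b1 * (t + y * v))%C) as H.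
    replace (b1 * 1)%C with b1 in H by ring.
    replace (b2 * 1 + b1 * (Cconj b1 * y + v))%C with (y + b1 * v)%C in H.
    2:{ transitivity (b2 + (b1 * Cconj b1) * y + b1 * v)%C; [|ring]. rewrite Hbb, E2. ring. }
    replace (b3 * 1 + b2 * (Cconj b1 * y + v) + b1 * (Cconj b1 * (t + y * v)))%C
      with (t + y * v)%C in H.
    2:{ transitivity (b3 + b2 * (Cconj b1 * y + v) + (b1 * Cconj b1) * (t + y * v))%C; [|ring].
        rewrite Hbb, E3, E2. ring. }
    rewrite Cmod_1, (Cmod_mult (Cconj b1)), Cmod_conj, Rpow_mult_distr in H.
    assert (HE : Cmod (y + b1 * v) ^ 2 - Cmod (Cconj b1 * y + v) ^ 2 =
                 D * (Cmod y ^ 2 - Cmod v ^ 2)).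
    { unfold D. rewrite !Cmod2_alt. destruct b1 as [x1 x2], y as [y1 y2], v as [w1 w2].
      simpl. ring. }
    apply Rmult_le_reg_l with D; [exact HD|]. unfold D in *. lra. }
  pose proof (Cmod_ge_0 y) as Hy0. pose proof (Cmod_ge_0 t) as Ht0.
  exists y, t. split; [exact E2|]. split; [exact E3|].
  pose proof (Hv 0) as Hv0. rewrite Cmult_0_r, Cplus_0_r, Cmod_0 in Hv0.
  assert (Hy : Cmod y <= 1) by nra.
  split; [exact Hy|].
  destruct (Rle_lt_or_eq_dec _ _ Hy) as [Hlt|Heq].
  - set (s := 1 - Cmod y ^ 2). assert (Hs : 0 < s) by (unfold s; nra).
    assert (Hsc : RtoC s <> RtoC 0) by (intros H; apply RtoC_inj in H; lra).
    (* This [v] maximises |t + y v|^2 - |v|^2 and turns the inequality into |t|^2 / s <= s. *)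
    pose proof (Hv (t * Cconj y / RtoC s)%C) as H.
    replace (t + y * (t * Cconj y / RtoC s))%C with (t / RtoC s)%C in H.
    2:{ transitivity (t + t * (y * Cconj y) / RtoC s)%C; [|field; exact Hsc].
        rewrite <- Cmod2_conj.
        replace (RtoC (Cmod y ^ 2)) with (1 - RtoC s)%C
          by (unfold s; rewrite RtoC_minus; ring).
        field. exact Hsc. }
    rewrite !Cmod_div, Cmod_mult, Cmod_conj, Cmod_R, Rabs_pos_eq in H by (exact Hsc || lra).
    fold s in H.
    assert (H' : Cmod t ^ 2 <= s ^ 2).
    { apply Rmult_le_reg_r with (/ s); [now apply Rinv_0_lt_compat|].
      replace (s ^ 2 * / s) with s by (field; lra).
      replace (Cmod t ^ 2 * / s) with ((Cmod t / s) ^ 2 - (Cmod t * Cmod y / s) ^ 2); [lra|].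
      replace (Cmod t ^ 2 * / s) with (Cmod t ^ 2 / s ^ 2 * s) by (field; lra).
      unfold s at 4. field. lra. }
    nra.
  (* When |y| = 1, the case v = 0 already forces t = 0. *)
  - rewrite Heq in *. nra.
Qed.

(** The triangle inequality is applied only after the Schur substitution, which extracts the factor
    1 - |b1|^2 from all terms in [b2] and [b3]. The case |b1| = 1, outside that substitution, is
    treated apart. *)
Lemma schur_cubic_functional_le (b1 b2 b3 : C) :
  toeplitz_contraction b1 b2 b3 ->
  Cmod (12 * b3 + 8 * b1 * b2 + 4 * b1 * b1 * b1 + 4 * b2 - 2 * b1 - 5) <= 17.75.
Proof.
  intros contraction. pose proof (schur_b1_le _ _ _ contraction) as Hb.
  pose proof (Cmod_ge_0 b1) as Hb0.
  assert (Htail : Cmod (4 * b1 * b1 * b1 - 2 * b1 - 5) <= 4 * Cmod b1 ^ 3 + 2 * Cmod b1 + 5).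
  { unfold Cminus. eapply Rle_trans; [apply Cmod_triangle|].
    eapply Rle_trans; [apply Rplus_le_compat_r, Cmod_triangle|].
    rewrite !Cmod_opp, !Cmod_mult, !Cmod_R, !Rabs_pos_eq by lra. simpl. lra. }
  destruct (Rle_lt_or_eq_dec _ _ Hb) as [Hlt|Heq].
  - destruct (schur_parameters _ _ _ contraction Hlt) as [y [t [E2 [E3 [Hy Ht]]]]].
    pose proof (Cmod_ge_0 y) as Hy0. pose proof (Cmod_ge_0 t) as Ht0.
    replace (12 * b3 + 8 * b1 * b2 + 4 * b1 * b1 * b1 + 4 * b2 - 2 * b1 - 5)%C
      with (RtoC (1 - Cmod b1 ^ 2) *
              (12 * t + - (12 * (Cconj b1 * y * y)) + 4 * y * (1 + 2 * b1)) +
            (4 * b1 * b1 * b1 - 2 * b1 - 5))%C by (rewrite E3, E2; ring).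
    set (r := Cmod b1) in *. set (s := Cmod y) in *.
    assert (HD : 0 <= 1 - r ^ 2) by nra.
    eapply Rle_trans; [apply Cmod_triangle|].
    rewrite Cmod_mult, Cmod_R, Rabs_pos_eq by exact HD.
    assert (Hhead : Cmod (12 * t + - (12 * (Cconj b1 * y * y)) + 4 * y * (1 + 2 * b1)) <=
                    12 * (1 - s ^ 2) + 12 * r * s ^ 2 + 4 * s * (1 + 2 * r)).
    { eapply Rle_trans; [apply Cmod_triangle|].
      apply Rplus_le_compat.
      - eapply Rle_trans; [apply Cmod_triangle|].
        rewrite Cmod_opp, !Cmod_mult, Cmod_conj, !Cmod_R, !Rabs_pos_eq by lra.
        fold r s. simpl in *. lra.
      - rewrite !Cmod_mult, Cmod_R, Rabs_pos_eq by lra. fold s.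
        apply Rmult_le_compat_l; [lra|].
        eapply Rle_trans; [apply Cmod_triangle|].
        rewrite Cmod_mult, !Cmod_R, !Rabs_pos_eq by lra. fold r. lra. }
    apply Rmult_le_compat_l with (r := 1 - r ^ 2) in Hhead; [|exact HD].
    (* [17.75] minus the bound is
       [12 (1 + r) ((1 - r) s - (1 + 2 r) / 6)^2 + 16/3 (r - 1/4)^2 (5/4 - r)]. *)
    assert (Hsos : 0 <= 12 * ((1 + r) * ((1 - r) * s - (1 + 2 * r) / 6) ^ 2) +
                        16 / 3 * ((r - 1 / 4) ^ 2 * (5 / 4 - r))).
    { apply Rplus_le_le_0_compat; apply Rmult_le_pos; try lra;
        apply Rmult_le_pos; try apply pow2_ge_0; lra. }
    simpl in *. nra.
  (* Only the terms in [b1] and the constant survive, with modulus at most 4 + 2 + 5 = 11. *)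
  - destruct (schur_b1_extremal _ _ _ contraction Heq) as [-> ->].
    replace (12 * 0 + 8 * b1 * 0 + 4 * b1 * b1 * b1 + 4 * 0 - 2 * b1 - 5)%C
      with (4 * b1 * b1 * b1 - 2 * b1 - 5)%C by ring.
    rewrite Heq in Htail. simpl in Htail. lra.
Qed.

(** * The third logarithmic coefficient *)

Lemma exp_taylor3 (x : R) :
  Rabs x <= 1 / 2 -> Rabs (exp x - (1 + x + x ^ 2 / 2 + x ^ 3 / 6)) <= 2 * Rabs x ^ 4.
Proof.
  intros Hx. pose proof (Rabs_pos x) as Hx0.
  set (s := fun n => / INR (Factorial.fact n) * x ^ n).
  assert (Hs : is_series s (exp x)) by apply (proj1 (is_pseries_R _ _ _)), is_exp_Reals.
  (* The tail is geometric of ratio |x| because 1/n! <= 1, and |x| <= 1/2 gives 1/(1 - |x|) <= 2. *)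
  apply Rle_trans with (Rabs x ^ 4 / (1 - Rabs x)).
  - apply (norm_series_geom (V := R_NormedModule) (fun k => s (4 + k)%nat) _ (Rabs x ^ 4) (Rabs x)).
    + lra.
    + intros n. change (Rabs (s (4 + n)%nat) <= Rabs x ^ 4 * Rabs x ^ n).
      unfold s. rewrite <- pow_add, Rabs_mult, <- RPow_abs.
      rewrite <- (Rmult_1_l (Rabs x ^ (4 + n))) at 2.
      apply Rmult_le_compat_r; [now apply pow_le|].
      assert (Hf : 1 <= INR (Factorial.fact (4 + n)))
        by (apply (le_INR 1), Nat.le_succ_l, Factorial.lt_O_fact).
      rewrite Rabs_pos_eq by (left; apply Rinv_0_lt_compat; lra).
      rewrite <- Rinv_1. apply Rinv_le_contravar; lra.
    + apply is_series_incr_n; [lia|].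
      replace (plus _ _) with (exp x); [exact Hs|].
      change (exp x = exp x - (1 + x + x ^ 2 / 2 + x ^ 3 / 6) + sum_n s 3).
      rewrite sum_n_Reals. unfold s. simpl. field.
  - apply Rmult_le_reg_r with (1 - Rabs x); [lra|].
    unfold Rdiv. rewrite Rmult_assoc, Rinv_l by lra.
    pose proof (pow_le (Rabs x) 4 Hx0). nra.
Qed.

(** The alternating partial sums enclose cos x between 1 - x^2/2 and 1 - x^2/2 + x^4/24. *)
Lemma cos_taylor3 (x : R) : Rabs x <= 1 / 2 -> Rabs (cos x - (1 - x ^ 2 / 2)) <= Rabs x ^ 4.
Proof.
  intros Hx. pose proof PI_RGT_0. pose proof PI2_1 as HPI.
  apply Rabs_le_between in Hx.
  destruct (cos_bound x 0) as [H1 H2]; [lra|lra|].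
  unfold cos_approx, cos_term in H1, H2. simpl in H1, H2.
  replace (Rabs x ^ 4) with (x ^ 4).
  - apply Rabs_le_between. pose proof (pow2_ge_0 (x ^ 2)). simpl in *. lra.
  - rewrite RPow_abs, Rabs_pos_eq; [reflexivity|].
    replace (x ^ 4) with ((x ^ 2) ^ 2) by ring. apply pow2_ge_0.
Qed.

(** The alternating enclosure has error y^5/120 for y >= 0, and y^5 <= y^4 there; negative arguments
    follow by oddness. *)
Lemma sin_taylor3 (x : R) : Rabs x <= 1 / 2 -> Rabs (sin x - (x - x ^ 3 / 6)) <= Rabs x ^ 4.
Proof.
  assert (Hpos : forall y, 0 <= y <= 1 / 2 -> Rabs (sin y - (y - y ^ 3 / 6)) <= y ^ 4).
  { intros y Hy. pose proof PI_RGT_0. pose proof PI2_1 as HPI.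
    destruct (pre_sin_bound y 0) as [H1 H2]; [lra|lra|].
    unfold sin_approx, sin_term in H1, H2. simpl in H1, H2.
    pose proof (pow_le y 4 (proj1 Hy)) as Hy4.
    assert (y ^ 5 <= y ^ 4) by (simpl in *; nra).
    apply Rabs_le_between. simpl in *. lra. }
  intros Hx. destruct (Rle_or_lt 0 x) as [H0|H0].
  - rewrite (Rabs_pos_eq x) in * by lra. apply Hpos. lra.
  - rewrite (Rabs_left x) in * by lra.
    specialize (Hpos (- x)). rewrite sin_neg in Hpos.
    rewrite <- Rabs_Ropp.
    replace (- (sin x - (x - x ^ 3 / 6))) with (- sin x - (- x - (- x) ^ 3 / 6)) by (simpl; field).
    apply Hpos. lra.
Qed.

Lemma Cmod_le_Rabs (x y : R) : Cmod (x, y) <= Rabs x + Rabs y.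
Proof.
  replace ((x, y) : C) with (RtoC x + RtoC y * Ci)%C
    by (apply injective_projections; simpl; ring).
  eapply Rle_trans; [apply Cmod_triangle|].
  rewrite Cmod_mult, !Cmod_R, Cmod_Ci. lra.
Qed.

Lemma Cmod_plus_le (a b : C) (A B : R) : Cmod a <= A -> Cmod b <= B -> Cmod (a + b) <= A + B.
Proof. intros Ha Hb. pose proof (Cmod_triangle a b). lra. Qed.

Lemma Cmod_mult_le (a b : C) (A B : R) : Cmod a <= A -> Cmod b <= B -> Cmod (a * b) <= A * B.
Proof.
  intros Ha Hb. rewrite Cmod_mult.
  apply Rmult_le_compat; try apply Cmod_ge_0; assumption.
Qed.

Lemma Cexp_taylor3 (w : C) :
  Cmod w <= 1 / 2 ->
  Cmod (Cexp w - (1 + w + w ^ 2 / 2 + w ^ 3 / 6)) <= 7 * Cmod w ^ 4.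
Proof.
  destruct w as [x y]. intros Hw. set (m := Cmod (x, y)) in *.
  pose proof (Rmax_Cmod (x, y)) as Hmax. simpl fst in Hmax. simpl snd in Hmax. fold m in Hmax.
  pose proof (Rle_trans _ _ _ (Rmax_l _ _) Hmax) as Hx.
  pose proof (Rle_trans _ _ _ (Rmax_r _ _) Hmax) as Hy.
  pose proof (Rabs_pos x) as Hx0. pose proof (Rabs_pos y) as Hy0.
  assert (Hm4 : 0 <= m ^ 4) by (apply pow_le; lra).
  set (e := 1 + x + x ^ 2 / 2 + x ^ 3 / 6).
  set (A1 := cos y - (1 - y ^ 2 / 2)). set (A2 := sin y - (y - y ^ 3 / 6)).
  set (X := RtoC x). set (Y := ((0, y) : C)).
  assert (HX : Cmod X <= m) by (unfold X; now rewrite Cmod_R).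
  assert (HY : Cmod Y <= m).
  { unfold Y. eapply Rle_trans; [apply Cmod_le_Rabs|]. rewrite Rabs_R0. lra. }
  pose proof (Cmod_ge_0 X) as HX0. pose proof (Cmod_ge_0 Y) as HY0.
  (* With X = x and Y = iy, the summands are the error of exp x, the error of cis y, and the terms
     of degree at least 4 in the product of the two cubic polynomials. They contribute 2, 4 and 1 to
     the constant 7. *)
  replace (Cexp (x, y) - (1 + (x, y) + (x, y) ^ 2 / 2 + (x, y) ^ 3 / 6))%C with
    (RtoC (exp x - e) * cis y + RtoC e * (A1, A2) +
     X * Y * (RtoC (1 / 6) * (X * X) + RtoC (1 / 4) * (X * Y) + RtoC (1 / 6) * (Y * Y) +
       RtoC (1 / 12) * (X * Y) * (X + Y) + RtoC (1 / 36) * (X * Y) * (X * Y)))%C.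
  2:{ unfold Cexp, cis, X, Y, e, A1, A2. apply injective_projections; simpl; field. }
  assert (He : Rabs e <= 2).
  { unfold e. apply Rabs_le_between in Hx. apply Rabs_le_between. simpl.
    assert (-1/2 <= x <= 1/2) by lra.
    assert (0 <= x * x <= 1/4) by nra. nra. }
  assert (Hxm : Rabs x ^ 4 <= m ^ 4) by (apply pow_incr; lra).
  assert (Hym : Rabs y ^ 4 <= m ^ 4) by (apply pow_incr; lra).
  pose proof (exp_taylor3 x ltac:(lra)) as H1. fold e in H1.
  pose proof (cos_taylor3 y ltac:(lra)) as H2.
  pose proof (sin_taylor3 y ltac:(lra)) as H3. fold A1 in H2. fold A2 in H3.
  assert (T1 : Cmod (RtoC (exp x - e) * cis y) <= 2 * m ^ 4).
  { rewrite Cmod_mult, Cmod_cis, Cmod_R. lra. }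
  assert (T2 : Cmod (RtoC e * (A1, A2)) <= 4 * m ^ 4).
  { rewrite Cmod_mult, Cmod_R.
    pose proof (Cmod_le_Rabs A1 A2) as H4.
    pose proof (Rabs_pos e).
    replace (4 * m ^ 4) with (2 * (2 * m ^ 4)) by ring.
    apply Rmult_le_compat; try apply Cmod_ge_0; lra. }
  assert (HXY : Cmod (X * Y) <= m * m) by now apply Cmod_mult_le.
  assert (T3 : Cmod (X * Y *
      (RtoC (1 / 6) * (X * X) + RtoC (1 / 4) * (X * Y) + RtoC (1 / 6) * (Y * Y) +
       RtoC (1 / 12) * (X * Y) * (X + Y) + RtoC (1 / 36) * (X * Y) * (X * Y))) <= m ^ 4).
  { apply Rle_trans with (m * m * (1 / 6 * (m * m) + 1 / 4 * (m * m) + 1 / 6 * (m * m) +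
      1 / 12 * (m * m) * (m + m) + 1 / 36 * (m * m) * (m * m))).
    - apply Cmod_mult_le; [exact HXY|].
      repeat apply Cmod_plus_le; repeat apply Cmod_mult_le; try assumption;
        try (rewrite Cmod_R, Rabs_pos_eq; lra).
      now apply Cmod_plus_le.
    - pose proof (Cmod_ge_0 (x, y)) as Hm0. fold m in Hm0.
      replace (m ^ 4) with (m * m * (m * m)) by ring.
      apply Rmult_le_compat_l; nra. }
  eapply Rle_trans; [apply Cmod_triangle|].
  eapply Rle_trans; [apply Rplus_le_compat_r, Cmod_triangle|]. lra.
Qed.

(** * Asymptotic expansions at 0 along the positive reals *)

Definition bigO (k : nat) (F : R -> C) : Prop :=
  exists M d, 0 <= M /\ 0 < d <= 1 /\ forall t, 0 < t < d -> Cmod (F t) <= M * t ^ k.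

Lemma bigO_ext (k : nat) (F G : R -> C) :
  (forall t, 0 < t < 1 -> F t = G t) -> bigO k F -> bigO k G.
Proof.
  intros HFG (M & d & HM & Hd & HF). exists M, d. split; [exact HM|]. split; [exact Hd|].
  intros t Ht. rewrite <- HFG by lra. now apply HF.
Qed.

Lemma bigO_plus (k : nat) (F G : R -> C) :
  bigO k F -> bigO k G -> bigO k (fun t => F t + G t)%C.
Proof.
  intros (M & d & HM & Hd & HF) (M' & d' & HM' & Hd' & HG).
  exists (M + M'), (Rmin d d'). split; [lra|].
  split; [split; [apply Rmin_pos; lra|eapply Rle_trans; [apply Rmin_l|lra]]|].
  intros t Ht. pose proof (Rmin_l d d'). pose proof (Rmin_r d d').
  rewrite Rmult_plus_distr_r. apply Cmod_plus_le; [apply HF|apply HG]; lra.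
Qed.

Lemma bigO_mult (j k : nat) (F G : R -> C) :
  bigO j F -> bigO k G -> bigO (j + k) (fun t => F t * G t)%C.
Proof.
  intros (M & d & HM & Hd & HF) (M' & d' & HM' & Hd' & HG).
  exists (M * M'), (Rmin d d'). split; [now apply Rmult_le_pos|].
  split; [split; [apply Rmin_pos; lra|eapply Rle_trans; [apply Rmin_l|lra]]|].
  intros t Ht. pose proof (Rmin_l d d'). pose proof (Rmin_r d d').
  replace (M * M' * t ^ (j + k)) with (M * t ^ j * (M' * t ^ k)) by (rewrite pow_add; ring).
  apply Cmod_mult_le; [apply HF|apply HG]; lra.
Qed.

(** Powers decrease with the exponent because [bigO] keeps t below d <= 1. *)
Lemma bigO_weaken (j k : nat) (F : R -> C) : (j <= k)%nat -> bigO k F -> bigO j F.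
Proof.
  intros Hjk (M & d & HM & Hd & HF). exists M, d. split; [exact HM|]. split; [exact Hd|].
  intros t Ht. eapply Rle_trans; [now apply HF|].
  apply Rmult_le_compat_l; [exact HM|].
  replace k with (j + (k - j))%nat by lia. rewrite pow_add.
  rewrite <- (Rmult_1_r (t ^ j)) at 2.
  apply Rmult_le_compat_l; [apply pow_le; lra|].
  rewrite <- (pow1 (k - j)). apply pow_incr. lra.
Qed.

Lemma bigO_monomial (k : nat) (c : C) : bigO k (fun t => c * RtoC t ^ k)%C.
Proof.
  exists (Cmod c), 1. split; [apply Cmod_ge_0|]. split; [lra|].
  intros t Ht. rewrite Cmod_mult, Cmod_pow, Cmod_R, Rabs_pos_eq; lra.
Qed.

Lemma bigO_scal (k : nat) (c : C) (F : R -> C) : bigO k F -> bigO k (fun t => c * F t)%C.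
Proof.
  intros HF. apply (bigO_mult 0 k (fun _ => c) F); [|exact HF].
  apply (bigO_ext 0 (fun t => c * RtoC t ^ 0)%C); [intros t _; simpl; ring|].
  apply bigO_monomial.
Qed.

Lemma bigO_minus (k : nat) (F G : R -> C) :
  bigO k F -> bigO k G -> bigO k (fun t => F t - G t)%C.
Proof.
  intros HF HG. apply (bigO_ext k (fun t => F t + (-1) * G t)%C); [intros t _; ring|].
  apply bigO_plus; [exact HF|now apply bigO_scal].
Qed.

Lemma bigO_monomial_eq_0 (k : nat) (c : C) : bigO (S k) (fun t => c * RtoC t ^ k)%C -> c = RtoC 0.
Proof.
  intros (M & d & HM & Hd & HF). apply Cmod_eq_0.
  pose proof (Cmod_ge_0 c) as Hc.
  destruct (Rle_lt_or_eq_dec _ _ Hc) as [Hpos|Heq]; [|now symmetry].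
  (* At this point M t < |c|, against the bound |c| <= M t obtained by cancelling t^k. *)
  set (t := Rmin (d / 2) (Cmod c / (2 * (M + 1)))).
  assert (Ht : 0 < t).
  { apply Rmin_pos; [lra|]. apply Rdiv_lt_0_compat; lra. }
  assert (Htd : t < d) by (pose proof (Rmin_l (d / 2) (Cmod c / (2 * (M + 1)))); fold t in H; lra).
  specialize (HF t (conj Ht Htd)).
  rewrite Cmod_mult, Cmod_pow, Cmod_R, Rabs_pos_eq in HF by lra.
  pose proof (pow_lt t k Ht) as Htk.
  assert (H1 : Cmod c <= M * t)
    by (apply Rmult_le_reg_r with (t ^ k); [exact Htk|]; simpl in HF; lra).
  assert (H2 : t * (2 * (M + 1)) <= Cmod c).
  { apply Rle_trans with (Cmod c / (2 * (M + 1)) * (2 * (M + 1))).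
    - apply Rmult_le_compat_r; [lra|apply Rmin_r].
    - right. field. lra. }
  nra.
Qed.

(** The coefficients are peeled off from the lowest order upwards. This is the uniqueness of
    expansions used to read off [gamma 3]. *)
Lemma bigO_cubic_eq_0 (c1 c2 c3 : C) :
  bigO 4 (fun t => c1 * RtoC t ^ 1 + c2 * RtoC t ^ 2 + c3 * RtoC t ^ 3)%C ->
  c1 = RtoC 0 /\ c2 = RtoC 0 /\ c3 = RtoC 0.
Proof.
  intros H.
  assert (H1 : c1 = RtoC 0).
  { apply (bigO_monomial_eq_0 1).
    apply (bigO_ext 2 (fun t => (c1 * RtoC t ^ 1 + c2 * RtoC t ^ 2 + c3 * RtoC t ^ 3) -
      c2 * RtoC t ^ 2 - c3 * RtoC t ^ 3)%C); [intros t _; ring|].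
    apply bigO_minus; [apply bigO_minus|].
    - now apply (bigO_weaken 2 4); [lia|].
    - apply bigO_monomial.
    - apply (bigO_weaken 2 3); [lia|apply bigO_monomial]. }
  assert (H2 : c2 = RtoC 0).
  { apply (bigO_monomial_eq_0 2).
    apply (bigO_ext 3 (fun t => (c1 * RtoC t ^ 1 + c2 * RtoC t ^ 2 + c3 * RtoC t ^ 3) -
      c3 * RtoC t ^ 3)%C); [intros t _; rewrite H1; ring|].
    apply bigO_minus; [|apply bigO_monomial].
    now apply (bigO_weaken 3 4); [lia|]. }
  split; [exact H1|]. split; [exact H2|].
  apply (bigO_monomial_eq_0 3). revert H. apply bigO_ext.
  intros t _. rewrite H1, H2. ring.
Qed.

Lemma disk_series_bigO (a : nat -> C) (F : C -> C) (n : nat) :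
  disk_series a F -> bigO (S n) (fun t => F (RtoC t) - Cpoly a n (RtoC t))%C.
Proof.
  intros Ha.
  destruct (disk_series_tail a F (1 / 2) Ha) as [B [HB Htail]]; [lra|].
  (* For t < 1/4 the ratio t/(1/2) = 2t is below 1/2, so dividing by 1 - 2t costs at most a factor
     2. *)
  exists (2 * B * 2 ^ S n), (1 / 4).
  split; [apply Rmult_le_pos; [lra|apply pow_le; lra]|]. split; [lra|].
  intros t Ht. specialize (Htail n (RtoC t)).
  rewrite Cmod_R, Rabs_pos_eq in Htail by lra.
  eapply Rle_trans; [apply Htail; lra|].
  replace (t / (1 / 2)) with (2 * t) by field.
  apply Rmult_le_reg_r with (1 - 2 * t); [lra|].
  unfold Rdiv. rewrite Rmult_assoc, Rinv_l, Rpow_mult_distr by lra.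
  pose proof (pow_le t (S n) ltac:(lra)). pose proof (pow_le 2 (S n) ltac:(lra)).
  assert (0 <= B * (2 ^ S n * t ^ S n)) by (apply Rmult_le_pos; [|apply Rmult_le_pos]; assumption).
  nra.
Qed.

Lemma bigO_Cexp (W : R -> C) :
  bigO 1 W -> bigO 4 (fun t => Cexp (W t) - (1 + W t + W t ^ 2 / 2 + W t ^ 3 / 6))%C.
Proof.
  intros (M & d & HM & Hd & HW).
  (* Below [d'] one has |W t| <= M t <= 1/2, the range of [Cexp_taylor3]. *)
  set (d' := Rmin d (1 / (2 * (M + 1)))).
  assert (Hd' : 0 < d') by (apply Rmin_pos; [lra|apply Rdiv_lt_0_compat; lra]).
  pose proof (Rmin_l d (1 / (2 * (M + 1))) : d' <= d) as Hl.
  pose proof (Rmin_r d (1 / (2 * (M + 1))) : d' <= _) as Hr.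
  exists (7 * M ^ 4), d'.
  split; [apply Rmult_le_pos; [lra|now apply pow_le]|]. split; [lra|].
  intros t Ht. specialize (HW t ltac:(lra)). rewrite pow_1 in HW.
  assert (Hsmall : M * t <= 1 / 2).
  { apply Rle_trans with ((M + 1) * (1 / (2 * (M + 1)))); [|right; field; lra].
    apply Rmult_le_compat; lra. }
  eapply Rle_trans; [apply Cexp_taylor3; lra|].
  rewrite Rmult_assoc, <- Rpow_mult_distr.
  apply Rmult_le_compat_l; [lra|]. apply pow_incr. split; [apply Cmod_ge_0|exact HW].
Qed.

(** At z = 0 the sum comes from [L 0 = 0]; elsewhere the given series is doubled and shifted, with 0
    as constant term. *)
Lemma log_coefficients_series (f : C -> C) (gamma : nat -> C) :
  log_coefficients f gamma ->
  exists L, log_branch f L /\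
    disk_series (fun n => match n with O => RtoC 0 | S _ => (2 * gamma n)%C end) L.
Proof.
  intros (L & HL & Hser). exists L. split; [exact HL|].
  intros z Hz. destruct (Ceq_dec z 0) as [->|Hz0].
  - destruct HL as (_ & HL0 & _). rewrite HL0.
    apply (proj1 (is_pseries_C _ _ _)).
    exact (is_pseries_0 (K := C_AbsRing) (V := C_NormedModule)
      (fun n => match n with O => RtoC 0 | S _ => (2 * gamma n)%C end)).
  - destruct (Hser z Hz Hz0) as (s & Hs & ->).
    pose proof (is_series_Cshift _ _ (is_series_Cmult_l 2 _ _ Hs)) as H.
    revert H. apply is_series_ext. intros [|n]; simpl; Ceq; ring.
Qed.

(** Comparing exp (L(t)) with f(t)/t up to t^3 gives a2 = g1, a3 = g2 + g1^2/2 and a4 = g3 + g1 g2 +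
    g1^3/6 for g_n = 2 gamma_n, which is solved for g3. *)
Lemma third_log_coefficient (f : C -> C) (a gamma : nat -> C) :
  disk_series a f -> a 0%nat = RtoC 0 -> a 1%nat = RtoC 1 -> log_coefficients f gamma ->
  (2 * gamma 3%nat)%C =
  (a 4%nat - a 2%nat * a 3%nat + a 2%nat * a 2%nat * a 2%nat / 3)%C.
Proof.
  intros Ha Ha0 Ha1 Hgamma.
  destruct (log_coefficients_series f gamma Hgamma) as (L & (_ & _ & HL) & Hser).
  set (g1 := (2 * gamma 1%nat)%C). set (g2 := (2 * gamma 2%nat)%C).
  set (g3 := (2 * gamma 3%nat)%C).
  set (W := fun t : R => L (RtoC t)).
  assert (HW3 : bigO 4 (fun t => W t - (g1 * RtoC t ^ 1 + g2 * RtoC t ^ 2 + g3 * RtoC t ^ 3))%C).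
  { generalize (disk_series_bigO _ _ 3 Hser). apply bigO_ext. intros t _.
    unfold Cpoly. rewrite !Csum_S, sum_O. unfold W, g1, g2, g3. simpl; ring. }
  (* The shorter expansions follow by putting the top monomial back into the remainder. *)
  assert (HW2 : bigO 3 (fun t => W t - (g1 * RtoC t ^ 1 + g2 * RtoC t ^ 2))%C).
  { apply (bigO_ext 3 (fun t => (W t - (g1 * RtoC t ^ 1 + g2 * RtoC t ^ 2 + g3 * RtoC t ^ 3)) +
      g3 * RtoC t ^ 3)%C); [intros t _; ring|].
    apply bigO_plus; [now apply (bigO_weaken 3 4); [lia|]|apply bigO_monomial]. }
  assert (HW1 : bigO 2 (fun t => W t - g1 * RtoC t ^ 1)%C).
  { apply (bigO_ext 2 (fun t => (W t - (g1 * RtoC t ^ 1 + g2 * RtoC t ^ 2)) +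
      g2 * RtoC t ^ 2)%C); [intros t _; ring|].
    apply bigO_plus; [now apply (bigO_weaken 2 3); [lia|]|apply bigO_monomial]. }
  assert (HW : bigO 1 W).
  { apply (bigO_ext 1 (fun t => (W t - g1 * RtoC t ^ 1) + g1 * RtoC t ^ 1)%C);
      [intros t _; ring|].
    apply bigO_plus; [now apply (bigO_weaken 1 2); [lia|]|apply bigO_monomial]. }
  (* The remainder splits into products of orders 2 + 2 and 1 + 3. *)
  assert (Hsq : bigO 4 (fun t => W t ^ 2 - (g1 * g1 * RtoC t ^ 2 + 2 * g1 * g2 * RtoC t ^ 3))%C).
  { apply (bigO_ext 4 (fun t =>
      (W t - g1 * RtoC t ^ 1) * (W t - g1 * RtoC t ^ 1) +
      2 * g1 * RtoC t ^ 1 * (W t - (g1 * RtoC t ^ 1 + g2 * RtoC t ^ 2)))%C);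
      [intros t _; ring|].
    apply bigO_plus; [now apply (bigO_mult 2 2)|].
    apply (bigO_mult 1 3); [apply bigO_monomial|exact HW2]. }
  assert (Hcu : bigO 4 (fun t => W t ^ 3 - g1 * g1 * g1 * RtoC t ^ 3)%C).
  { apply (bigO_ext 4 (fun t => (W t - g1 * RtoC t ^ 1) *
      (W t * W t + (g1 * RtoC t ^ 1) * W t + (g1 * RtoC t ^ 1) * (g1 * RtoC t ^ 1)))%C);
      [intros t _; ring|].
    apply (bigO_mult 2 2); [exact HW1|].
    apply bigO_plus; [apply bigO_plus|]; apply (bigO_mult 1 1);
      try exact HW; apply bigO_monomial. }
  assert (Hf : bigO 4 (fun t => Cexp (W t) -
    (1 + a 2%nat * RtoC t ^ 1 + a 3%nat * RtoC t ^ 2 + a 4%nat * RtoC t ^ 3))%C).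
  (* The expansion of [f] has remainder of order 5, since division by t loses one order. *)
  { destruct (disk_series_bigO a f 4 Ha) as (M & d & HM & Hd & HF).
    exists M, d. split; [exact HM|]. split; [exact Hd|]. intros t Ht. specialize (HF t Ht).
    assert (Ht0 : RtoC t <> RtoC 0) by (intros H; apply RtoC_inj in H; lra).
    assert (Htu : unit_disk (RtoC t)) by (unfold unit_disk; rewrite Cmod_R, Rabs_pos_eq; lra).
    unfold W. rewrite (HL _ Htu Ht0).
    replace (f (RtoC t) / RtoC t -
      (1 + a 2%nat * RtoC t ^ 1 + a 3%nat * RtoC t ^ 2 + a 4%nat * RtoC t ^ 3))%C
      with ((f (RtoC t) - Cpoly a 4 (RtoC t)) / RtoC t)%C.
    2:{ unfold Cpoly. rewrite !Csum_S, sum_O, Ha0, Ha1. field. exact Ht0. }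
    rewrite Cmod_div, Cmod_R, Rabs_pos_eq by (exact Ht0 || lra).
    apply Rmult_le_reg_r with t; [lra|].
    unfold Rdiv. rewrite Rmult_assoc, Rinv_l by lra. simpl in *. lra. }
  destruct (bigO_cubic_eq_0 (a 2%nat - g1) (a 3%nat - (g2 + g1 * g1 / 2))
    (a 4%nat - (g3 + g1 * g2 + g1 * g1 * g1 / 6))) as (E1 & E2 & E3).
  (* In this combination of remainders, [Cexp (W t)] and all powers of [W t] cancel and only the
     cubic polynomial is left. *)
  - apply (bigO_ext 4 (fun t =>
      (Cexp (W t) - (1 + W t + W t ^ 2 / 2 + W t ^ 3 / 6)) -
      (Cexp (W t) -
        (1 + a 2%nat * RtoC t ^ 1 + a 3%nat * RtoC t ^ 2 + a 4%nat * RtoC t ^ 3)) +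
      (W t - (g1 * RtoC t ^ 1 + g2 * RtoC t ^ 2 + g3 * RtoC t ^ 3)) +
      / 2 * (W t ^ 2 - (g1 * g1 * RtoC t ^ 2 + 2 * g1 * g2 * RtoC t ^ 3)) +
      / 6 * (W t ^ 3 - g1 * g1 * g1 * RtoC t ^ 3))%C).
    + intros t _. field.
    + apply bigO_plus; [apply bigO_plus; [apply bigO_plus; [apply bigO_minus|]|]|];
        try (apply bigO_scal); try assumption. now apply bigO_Cexp.
  - apply Ceq_minus in E1, E2, E3. rewrite E1, E2, E3. field.
Qed.

Theorem theorem2p3 (f : C -> C) (gamma : nat -> C)
    (hf : class_F3 f) (hgamma : log_coefficients f gamma) :
  Cmod (gamma 3%nat) <= 17.75 / 48 /\ 0.36979 <= 17.75 / 48 < 0.36980.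
Proof.
  split; [|lra].
  destruct hf as [[[_ (a & Ha0 & Ha1 & Hps)] _] Hre].
  assert (Ha : disk_series a f) by (intros z Hz; apply is_pseries_C, Hps, Hz).
  pose proof (disk_series_quadratic_mult _ _ (disk_series_C_derive a f Ha)) as Hc.
  (* [b1], [b2] and [b3] solve the coefficient equations of (1 - z + z^2) f' = (1 + w)/(1 - w),
     whose left side has coefficients 2 a2 - 1, 3 a3 - 2 a2 + 1 and 4 a4 - 3 a3 + 2 a2. *)
  set (b1 := (a 2%nat - 1 / 2)%C).
  set (b2 := ((3 * a 3%nat - 2 * a 2%nat + 1 - 2 * b1 * b1) / 2)%C).
  set (b3 := ((4 * a 4%nat - 3 * a 3%nat + 2 * a 2%nat - 4 * b1 * b2 - 2 * b1 * b1 * b1) / 2)%C).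
  assert (Hcontr := caratheodory_toeplitz_contraction b1 b2 b3 _ _ Hc
    (fun z Hz => Rlt_le _ _ (Hre z Hz))).
  cbv beta iota in Hcontr. rewrite Ha1 in Hcontr.
  assert (HINR : INR 1 = 1 /\ INR 2 = 2 /\ INR 3 = 3 /\ INR 4 = 4)
    by (simpl; repeat split; ring).
  destruct HINR as (I1 & I2 & I3 & I4). rewrite I1, I2, I3, I4 in Hcontr.
  pose proof (schur_cubic_functional_le b1 b2 b3) as Hbound.
  replace (12 * b3 + 8 * b1 * b2 + 4 * b1 * b1 * b1 + 4 * b2 - 2 * b1 - 5)%C
    with (48 * gamma 3%nat)%C in Hbound.
  - rewrite Cmod_mult, Cmod_R, Rabs_pos_eq in Hbound by lra.
    enough (48 * Cmod (gamma 3%nat) <= 17.75) by lra.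
    apply Hbound, Hcontr; unfold b3, b2, b1; field.
  - transitivity (24 * (2 * gamma 3%nat))%C; [ring|].
    rewrite (third_log_coefficient f a gamma Ha Ha0 Ha1 hgamma).
    unfold b3, b2, b1. field.
Qed.
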